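(* Let $D$ be a dihedral group of order $8$ and let $L$ be a free abelian group of finite (even) rank with an action of $D$ in which the central involution acts as $-1$. For $L$, the properties $2/4$-generation and $3/4$-generation are equivalent.
   Context: For an involution $s$ of $D$, $L^+(s)=\{v\in L: vs=v\}$. The $2/4$-generation property is the condition that $L$ is generated by the fixed points of a generating pair of involutions in $D$, i.e. $L=L^+(a)+L^+(b)$ for involutions $a,b$ generating $D$. The $3/4$-generation property is the condition that $L$ is generated by the fixed points of any three noncentral involutions of $D$, i.e. $L=L^+(a)+L^+(b)+L^+(c)$ for any three distinct noncentral involutions $a,b,c$ of $D$. *)

(* Defs.v *)
From HB Require Import structures.
From mathcomp Require Import all_boot all_order all_algebra.
From mathcomp Require Import all_fingroup all_solvable.

Set Implicit Arguments.
Unset Strict Implicit.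
Unset Printing Implicit Defensive.

Import GRing.Theory GroupScope.
Local Open Scope ring_scope.

(* MathComp actions are right actions, [to v g] standing for vg. Their axioms
   only make each [to^~ g] a permutation of the carrier; additivity is the
   separate hypothesis that turns L into a D-module. *)
Definition additive_action (gT : finGroupType) (D : {group gT})
    (L : zmodType) (to : action D L) : Prop :=
  forall g : gT, g \in D -> {morph to^~ g : u v / u + v}.

Definition fixed_points (gT : finGroupType) (D : {group gT})
    (L : zmodType) (to : action D L) (s : gT) : {pred L} :=
  [pred v | to v s == v].

Definition involution (gT : finGroupType) (D : {group gT}) (s : gT) : Prop :=
  s \in D /\ #[s]%g = 2%N.

Definition noncentral_involution (gT : finGroupType) (D : {group gT})
    (s : gT) : Prop :=
  involution D s /\ s \notin 'Z(D)%g.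

(* All generating pairs of involutions of a dihedral group of order 8 are
   conjugate, so quantifying existentially over them is harmless. *)
Definition two_four_generation (gT : finGroupType) (D : {group gT})
    (L : zmodType) (to : action D L) : Prop :=
  exists a b : gT,
    [/\ involution D a, involution D b, <<[set a; b]>>%g = D
      & forall v : L, exists x y : L,
          [/\ x \in fixed_points to a, y \in fixed_points to b & v = x + y]].

Definition three_four_generation (gT : finGroupType) (D : {group gT})
    (L : zmodType) (to : action D L) : Prop :=
  forall a b c : gT,
    noncentral_involution D a -> noncentral_involution D b ->
    noncentral_involution D c -> a != b -> a != c -> b != c ->
    forall v : L, exists x y z : L,
      [/\ x \in fixed_points to a, y \in fixed_points to b,
          z \in fixed_points to c & v = x + y + z].

(* Main.v *)
Require Import Defs.
From HB Require Import structures.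
From mathcomp Require Import all_boot all_order all_algebra.
From mathcomp Require Import all_fingroup all_solvable.

Set Implicit Arguments.
Unset Strict Implicit.
Unset Printing Implicit Defensive.

Import GRing.Theory GroupScope.
Local Open Scope ring_scope.

(** Write L^+(s) for the fixed points of s. Let a, b be non-commuting
involutions of D. The commutator of a and b is the central involution z, so
a^b = az, b^a = bz, and the noncentral involutions of D are exactly the four
elements a, az, b, bz ([noncentral_involution_cases]).

Suppose L = L^+(a) + L^+(b). Conjugating by a, by b, and by ab turns the pair
(a, b) into each of the other pairs with one entry in {a, az} and the other in
{b, bz} ([generated_by_fixedJ]). Three distinct noncentral involutions always
contain such a pair, by the pigeonhole principle, so their fixed points
generate L.

Conversely, suppose that the fixed points of a, az and b generate L. Since b
exchanges L^+(a) and L^+(az), a vector n of L^+(az) is the sum of n + nb, which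
b fixes, and of -nb, which a fixes. Hence L^+(az) is contained in
L^+(a) + L^+(b), and L = L^+(a) + L^+(b) ([generated_by_fixed_absorb]). *)

(** * Fixed points of involutions in a module *)

Section FixedPoints.

Variables (gT : finGroupType) (D : {group gT}) (L : zmodType).
Variable to : action D L.
Hypothesis to_additive : additive_action to.

Lemma module_actM v : {in D &, act_morph to v}.
Proof. by case: to => ? []. Qed.

Lemma module_act1 v : to v 1%g = v.
Proof.
have act_inj : left_injective to by case: to => ? [].
by apply: (act_inj 1%g); rewrite -module_actM ?group1 ?mulg1.
Qed.

Lemma module_actN v g : g \in D -> to (- v) g = - to v g.
Proof.
move=> Dg; have actD := to_additive Dg.
have act0 : to 0 g = 0.
  by apply: (addrI (to 0 g)); rewrite -actD !addr0.
by apply/eqP; rewrite -addr_eq0 -actD addNr act0.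
Qed.

Lemma fixed_pointsJ v s g : s \in D -> g \in D ->
  v \in fixed_points to s -> to v g \in fixed_points to (s ^ g)%g.
Proof.
rewrite !inE => Ds Dg /eqP vs.
by rewrite -module_actM ?groupJ // -conjgC module_actM // vs.
Qed.

Lemma fixed_pointsN v s : s \in D ->
  v \in fixed_points to s -> - v \in fixed_points to s.
Proof. by rewrite !inE => Ds /eqP vs; rewrite module_actN ?vs. Qed.

Lemma fixed_pointsD v w s : s \in D -> v \in fixed_points to s ->
  w \in fixed_points to s -> v + w \in fixed_points to s.
Proof.
by rewrite !inE => Ds /eqP vs /eqP ws; rewrite (to_additive Ds) vs ws.
Qed.

Lemma fixed_points0 s : s \in D -> 0 \in fixed_points to s.
Proof.
by move=> Ds; rewrite inE -{1}(subrr 0) (to_additive Ds) module_actN ?subrr.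
Qed.

Definition generated_by_fixed (s t : gT) : Prop :=
  forall v : L, exists x y : L,
    [/\ x \in fixed_points to s, y \in fixed_points to t & v = x + y].

Lemma generated_by_fixedC s t :
  generated_by_fixed s t -> generated_by_fixed t s.
Proof.
by move=> st v; have [x [y [? ? ->]]] := st v; exists y, x; rewrite addrC.
Qed.

(** The sum L^+(s^g) + L^+(t^g) is the image under g of L^+(s) + L^+(t). *)
Lemma generated_by_fixedJ s t g : s \in D -> t \in D -> g \in D ->
  generated_by_fixed s t -> generated_by_fixed (s ^ g)%g (t ^ g)%g.
Proof.
move=> Ds Dt Dg st v; have [x [y [xs yt def_v]]] := st (to v g^-1%g).
exists (to x g), (to y g); split; try exact: fixed_pointsJ.
rewrite -(to_additive Dg) -def_v -module_actM ?groupV //.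
by rewrite mulVg module_act1.
Qed.

(** For n fixed by s^t, the decomposition n = - nt + (n + nt) has its first
summand in L^+(s) and its second in L^+(t). *)
Lemma generated_by_fixed_absorb s t : s \in D -> t \in D -> #[t]%g = 2%N ->
    (forall v, exists x y z, [/\ x \in fixed_points to s,
        y \in fixed_points to (s ^ t)%g, z \in fixed_points to t
      & v = x + y + z]) ->
  generated_by_fixed s t.
Proof.
move=> Ds Dt ot gen3 v; have [m [n [p [ms nst pt ->]]]] := gen3 v.
have tt : (t * t = 1)%g by have := expg_order t; rewrite ot expgS expg1.
have nts : to n t \in fixed_points to s.
  by rewrite -[s](conjgK t) (mulg1_eq tt) fixed_pointsJ ?groupJ.
exists (m - to n t), (n + to n t + p); split.
- by rewrite fixed_pointsD ?fixed_pointsN.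
- rewrite fixed_pointsD // inE (to_additive Dt) -module_actM // tt.
  by rewrite module_act1 addrC.
by rewrite -[n + _ + p]addrA [n + _]addrCA [RHS]addrA subrK addrA.
Qed.

(** Three distinct elements cannot all lie in one of the pairs {s, s'} and
{t, t'}, so two of them come from different pairs; the summand fixed by the
remaining one is 0. *)
Lemma generated_by_fixed3 (s s' t t' a b c : gT) :
    {in [set s; s'] & [set t; t'], forall g h, generated_by_fixed g h} ->
    a \in D -> b \in D -> c \in D -> a != b -> a != c -> b != c ->
    a \in [set s; s'] :|: [set t; t'] -> b \in [set s; s'] :|: [set t; t'] ->
    c \in [set s; s'] :|: [set t; t'] ->
  forall v : L, exists x y z : L,
    [/\ x \in fixed_points to a, y \in fixed_points to b,
        z \in fixed_points to c & v = x + y + z].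
Proof.
move=> gen Da Db Dc nab nac nbc.
have pigeon (u u' : gT) : a \in [set u; u'] -> b \in [set u; u'] ->
    c \in [set u; u'] -> False.
  rewrite !inE => /orP[] /eqP ea /orP[] /eqP eb /orP[] /eqP ec;
  by move: nab nac nbc; rewrite ea eb ec ?eqxx.
have genC g h : h \in [set s; s'] -> g \in [set t; t'] ->
    generated_by_fixed g h.
  by move=> Sh Tg; apply/generated_by_fixedC/gen.
move=> Ua Ub Uc v.
have [gab|[gac|gbc]] : generated_by_fixed a b \/
    (generated_by_fixed a c \/ generated_by_fixed b c).
- case/setUP: Ua => Ha; case/setUP: Ub => Hb; case/setUP: Uc => Hc;
  by [case: (pigeon _ _ Ha Hb Hc) | left; auto | right; left; auto].
- have [x [y [xa yb ->]]] := gab v; exists x, y, 0.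
  by rewrite addr0; split; rewrite ?fixed_points0.
- have [x [z [xa zc ->]]] := gac v; exists x, 0, z.
  by rewrite addr0; split; rewrite ?fixed_points0.
have [y [z [yb zc ->]]] := gbc v; exists 0, y, z.
by rewrite add0r; split; rewrite ?fixed_points0.
Qed.

End FixedPoints.

(** * Noncentral involutions of the dihedral group of order 8 *)

Section Dihedral8.

Local Open Scope group_scope.

Variables (gT : finGroupType) (D : {group gT}).
Hypothesis D_dihedral8 : D \isog 'D_8.

(** The noncentral involutions lie outside the cyclic subgroup of order 4,
because the only involution of a cyclic group of order 4 is its square, which
is central here. *)
Lemma dihedral8_structure : exists x y : gT,
  [/\ [/\ #[x] = 4, x \in D, y \in D :\: <[x]> & #|D :\: <[x]>| = 4],
      <[x]> * <[y]> = D /\ x ^ y = x^-1,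
      #|'Z(D)| = 2 /\ D^`(1) = 'Z(D),
      {in D :\: <[x]>, forall t, #[t] = 2}
    & forall t, noncentral_involution D t -> t \in D :\: <[x]>].
Proof.
have [[x y] genG [_ xy]] := generators_2dihedral (isT : 1 < 3)%N D_dihedral8.
have [oD Dx ox X'y] := genG.
have [defG [D1 _ _ _] _ _ [defZ oZ _ _ _]] :=
  dihedral2_structure (isT : 1 < 3)%N genG D_dihedral8.
have [sdp inv2 _] := defG.
have sXD : <[x]> \subset D by rewrite cycle_subG.
have sZX : 'Z(D) \subset <[x]> by rewrite defZ cycle_subG mem_cycle.
exists x, y; split=> //.
- by split=> //; rewrite cardsD (setIidPr sXD) -orderE ox oD.
- by split=> //; case/sdprodP: sdp.
- by split=> //; rewrite D1 defZ.
move=> t [[Dt ot] Z't]; rewrite inE Dt andbT.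
apply: contra Z't => Xt; rewrite -cycle_subG.
suffices /eqP-> : <[t]> == 'Z(D) by [].
rewrite (@eq_subG_cyclic _ <[x]>) ?cycle_cyclic ?cycle_subG //.
by rewrite -orderE ot oZ.
Qed.

(** Commutators lie in the derived subgroup, which is the center {1, z}. *)
Lemma dihedral8_conj_center :
  exists2 z, z \in 'Z(D) & {in D &, forall a b, a ^ b != a -> a ^ b = a * z}.
Proof.
have [x [y [_ _ [oZ D1] _ _]]] := dihedral8_structure.
have [z defZ] : exists z, 'Z(D) = [set 1; z].
  have /cards2P[u [w [_ Zuw]]] : #|'Z(D)| == 2 by rewrite oZ.
  have : 1 \in 'Z(D) := group1 _.
  rewrite Zuw => /set2P[] e1.
    by exists w; rewrite e1.
  by exists u; rewrite e1 setUC.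
exists z => [|a b Da Db nab]; first by rewrite defZ set22.
rewrite [a ^ b]conjg_mulR; congr (_ * _).
have : [~ a, b] \in D^`(1) by rewrite mem_commg.
rewrite D1 defZ !inE => /orP[/eqP ab1|/eqP //].
by case/eqP: nab; rewrite conjg_mulR ab1 mulg1.
Qed.

Lemma conjg_self (a : gT) : a ^ a = a.
Proof. by rewrite conjgE mulKg. Qed.

Lemma conjg_fixC (a b : gT) : (a ^ b == a) = (b ^ a == b).
Proof. by apply/eqP/eqP => /conjg_fixP/commgP c; apply/conjg_fixP/commgP. Qed.

Lemma noncentral_involutionJ a g :
  g \in D -> noncentral_involution D a -> noncentral_involution D (a ^ g).
Proof.
move=> Dg [[Da oa] Z'a]; split; first by split; rewrite ?groupJ // orderJ.
by rewrite memJ_norm // (subsetP (normal_norm (center_normal D))).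
Qed.

Lemma noncommuting_noncentral a b :
  involution D a -> b \in D -> a ^ b != a -> noncentral_involution D a.
Proof.
move=> Ia Db nab; split=> //; apply: contra nab => /centerP[_ cDa].
by apply/eqP/conjg_fixP/commgP/cDa.
Qed.

(** By cardinality: the elements on the right are pairwise distinct and lie
outside the cyclic subgroup of order 4, whose complement has four elements. *)
Lemma noncentral_involution_cases a b t :
  involution D a -> involution D b -> a ^ b != a ->
  noncentral_involution D t -> t \in [set a; a ^ b] :|: [set b; b ^ a].
Proof.
move=> Ia Ib nab It; have [[Da _] [Db _]] := (Ia, Ib).
have [x [y [[_ _ _ oX'] _ _ _ inX']]] := dihedral8_structure.
have [z _ conjz] := dihedral8_conj_center.
have nba : b ^ a != b by rewrite -conjg_fixC.
have neq_ab : a != b by apply: contra nab => /eqP->; rewrite conjg_self.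
have NIa := noncommuting_noncentral Ia Db nab.
have NIb := noncommuting_noncentral Ib Da nba.
have uniq_s : uniq [:: a; a ^ b; b; b ^ a].
  rewrite /= !inE !negb_or !andbT -!andbA [a == a ^ b]eq_sym [b == b ^ a]eq_sym.
  rewrite nab neq_ab nba andbT /=; apply/and3P; split.
  - by rewrite -{1}(conjg_self a) (inj_eq (conjg_inj a)).
  - by rewrite -{2}(conjg_self b) (inj_eq (conjg_inj b)).
  by rewrite (conjz a b) // (conjz b a) // (inj_eq (mulIg z)) neq_ab.
have sub_s : {subset [:: a; a ^ b; b; b ^ a] <= enum (D :\: <[x]>)}.
  move=> g; rewrite mem_enum !inE => /or4P[] /eqP->; rewrite -in_setD;
  by apply: inX' => //; apply: noncentral_involutionJ.
have [|_ eq_s] := uniq_min_size uniq_s sub_s; first by rewrite -cardE oX'.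
by rewrite !inE -orbA; have := eq_s t; rewrite mem_enum (inX' t) // !inE => ->.
Qed.

(** A reflection y and its product with a rotation x of order 4. They do not
commute because x^y = x^-1 differs from x. *)
Lemma dihedral8_generators : exists a b,
  [/\ involution D a, involution D b, <<[set a; b]>> = D & a ^ b != a].
Proof.
have [x [y [[ox Dx X'y _] [defD xy] _ inv2 _]]] := dihedral8_structure.
have [Dy notXy] := setDP X'y.
have X'xy : x * y \in D :\: <[x]>.
  by apply/setDP; split; [rewrite groupM | rewrite groupMl ?cycle_id].
exists y, (x * y); split; try by split; rewrite ?groupM ?inv2.
  apply/eqP; rewrite eqEsubset gen_subG; apply/andP; split.
    by apply/subsetP=> g /set2P[] ->; rewrite ?groupM.
  have Hy : y \in <<[set y; x * y]>> by rewrite mem_gen ?set21.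
  have Hx : x \in <<[set y; x * y]>>.
    by rewrite -(groupMr _ Hy) mem_gen ?set22.
  by rewrite -defD mul_subG ?cycle_subG.
rewrite -conjg_fixC conjMg conjg_self xy (inj_eq (mulIg y)).
by rewrite eq_invg_mul -expg2 -order_dvdn ox.
Qed.

(** If a and b commuted, the group they generate would be abelian, while the
derived subgroup of D has order 2. *)
Lemma dihedral8_generators_noncommuting a b :
  a \in D -> b \in D -> <<[set a; b]>> = D -> a ^ b != a.
Proof.
move=> Da Db defD; have [x [y [_ _ [oZ D1] _ _]]] := dihedral8_structure.
apply/negP => /eqP/conjg_fixP/commgP cab.
have abD : abelian D.
  rewrite -defD abelian_gen; apply/centsP => g /set2P[] -> h /set2P[] -> //.
by move: oZ; rewrite -D1 (derG1P abD) cards1.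
Qed.

End Dihedral8.

(* A [vectType int] is a Z-module isomorphic to Z^n with n = dim L, i.e. a free
   abelian group of finite rank. *)
Theorem lemma2p15 (gT : finGroupType) (D : {group gT})
    (D_dihedral8 : D \isog 'D_8)
    (L : vectType int) (rank_even : ~~ odd (dim L))
    (to : action D L) (to_additive : additive_action to)
    (central_opp : forall z : gT, involution D z -> z \in 'Z(D)%g ->
                   forall v : L, to v z = - v) :
  two_four_generation to <-> three_four_generation to.
Proof.
split=> [[a [b [Ia Ib defD gen]]] | gen3].
  have [[Da _] [Db _]] := (Ia, Ib).
  have nab := dihedral8_generators_noncommuting D_dihedral8 Da Db defD.
  have nba : (b ^ a != b)%g by rewrite -conjg_fixC.
  have cover := noncentral_involution_cases D_dihedral8 Ia Ib nab.
  have [z Zz conjz] := dihedral8_conj_center D_dihedral8.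
  have genJ g : g \in D -> generated_by_fixed to (a ^ g)%g (b ^ g)%g.
    by move=> Dg; apply: generated_by_fixedJ.
  have gen4 : {in [set a; a ^ b]%g & [set b; b ^ a]%g,
      forall g h, generated_by_fixed to g h}.
    move=> g h /set2P[] -> /set2P[] ->.
    - exact: gen.
    - by have := genJ a Da; rewrite conjg_self.
    - by have := genJ b Db; rewrite conjg_self.
    (* Conjugation by ab sends a to a^b, and b to (b^a)^b = b^a, since b^a = bz
       with z central. *)
    have cbz : (z ^ b = z)%g.
      by case/centerP: Zz => _ cDz; apply/conjg_fixP/commgP/cDz.
    have := genJ (a * b)%g (groupM Da Db).
    by rewrite !conjgM conjg_self (conjz b a) // conjMg conjg_self cbz.
  move=> p q r Ip Iq Ir npq npr nqr.
  have [[[Dp _] _] [[Dq _] _] [[Dr _] _]] := And3 Ip Iq Ir.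
  by apply: (generated_by_fixed3 to_additive gen4); rewrite ?cover.
have [a [b [Ia Ib defD nab]]] := dihedral8_generators D_dihedral8.
have [[Da oa] [Db ob]] := (Ia, Ib); exists a, b; split=> //.
have nba : (b ^ a != b)%g by rewrite -conjg_fixC.
have neq_ab : a != b by apply: contra nab => /eqP->; rewrite conjg_self.
have NIa := noncommuting_noncentral Ia Db nab.
have NIb := noncommuting_noncentral Ib Da nba.
apply: generated_by_fixed_absorb => //.
apply: gen3 => //; first exact: noncentral_involutionJ.
  by rewrite eq_sym.
by rewrite -{2}(conjg_self b) (inj_eq (conjg_inj b)).
Qed.
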